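(* Let $\mathbf{A}$ be a finite set of indeterminates and $X,Y\notin\mathbf{A}$ distinct. Consider the equation system $\mathcal{E}\colon X=P(X,Y),\ Y=Q(X,Y)$ with $P,Q\in\mathbb{S}^{\infty}[\mathbf{A}\cup\{X,Y\}]$. Let $H(Y)\in\mathbb{S}^{\infty}[\mathbf{A}\cup\{Y\}]$ be the greatest solution in $\mathbb{S}^{\infty}[\mathbf{A}\cup\{Y\}]$ of the equation $X=P(X,Y)$ (treating $Y$ as a coefficient indeterminate), and let $b\in\mathbb{S}^{\infty}[\mathbf{A}]$ be the greatest solution in $\mathbb{S}^{\infty}[\mathbf{A}]$ of the equation $Y=Q(H(Y),Y)$. Then $(H(b),b)$ is the greatest solution of $\mathcal{E}$ in $\mathbb{S}^{\infty}[\mathbf{A}]$.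
   Context: $\mathbb{S}^{\infty}[\mathbf{Z}]$ for a finite indeterminate set $\mathbf{Z}$: a monomial is a map $m\colon\mathbf{Z}\to\mathbb{N}\cup\{\infty\}$, multiplied by adding exponents; $m_1\succeq m_2$ if $m_1(Z)\le m_2(Z)$ for all $Z$. Elements are (finite) antichains of monomials w.r.t. $\succeq$; $P+Q=\mathsf{Maximals}(P\cup Q)$, $P\cdot Q=\mathsf{Maximals}\{m_1m_2\}$, $0=\emptyset$, $1=\{$constant monomial$\}$. It is an absorptive, fully-continuous commutative semiring, with natural order $a\le b$ iff $a+b=b$; greatest solutions are with respect to this order (componentwise for pairs). Substitution of elements for indeterminates followed by evaluation is written as function application, e.g. $H(b)$, $Q(H(Y),Y)$. *)

(* Defs.v *)
From HB Require Import structures.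
From mathcomp Require Import all_boot all_order all_algebra.
From mathcomp Require Import finmap.
From mathcomp Require Import zify.
Set Implicit Arguments.
Unset Strict Implicit.
Unset Printing Implicit Defensive.

Import Order.TTheory GRing.Theory.
Local Open Scope fset_scope.
Local Open Scope ring_scope.

(* [None] is the exponent [oo]. *)
Definition enat : Type := option nat.
HB.instance Definition _ := Countable.on enat.

Definition enat_add (e f : enat) : enat :=
  match e, f with Some i, Some j => Some (i + j)%N | _, _ => None end.

Definition enat_le (e f : enat) : bool :=
  match e, f with
  | Some i, Some j => (i <= j)%N
  | Some _, None => true
  | None, Some _ => false
  | None, None => true
  end.

Lemma enat_addA : associative enat_add.
Proof. by move=> [i|] [j|] [k|] //=; rewrite addnA. Qed.
Lemma enat_addC : commutative enat_add.
Proof. by move=> [i|] [j|] //=; rewrite addnC. Qed.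
Lemma enat_add0 : left_id (Some 0%N : enat) enat_add.
Proof. by case. Qed.
HB.instance Definition _ :=
  GRing.isNmodule.Build enat enat_addA enat_addC enat_add0.

Lemma enat_le_refl : reflexive enat_le.
Proof. by case=> [i|] //=. Qed.
Lemma enat_le_trans : transitive enat_le.
Proof. by move=> [j|] [i|] [k|] //=; apply: leq_trans. Qed.
Lemma enat_le_anti : antisymmetric enat_le.
Proof. by move=> [i|] [j|] //= /anti_leq ->. Qed.

(* Monomials are written additively: the product of two monomials is the      *)
(* pointwise sum [m1 + m2] of their exponents, and [0] is the monomial 1.     *)
Definition monomial (Z : finType) := {ffun Z -> enat}.

(* [m1] absorbs [m2]: the relation m1 >= m2 with smaller exponents on top. *)
Definition absorbs (Z : finType) (m1 m2 : monomial Z) : bool :=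
  [forall z, enat_le (m1 z) (m2 z)].

Definition antichain (Z : finType) (S : {fset monomial Z}) : bool :=
  [forall m1 : S, forall m2 : S, absorbs (val m1) (val m2) ==> (m1 == m2)].

Definition maximals (Z : finType) (S : {fset monomial Z}) :
    {fset monomial Z} :=
  [fset m in S | [forall m' : S, absorbs (val m') m ==> (val m' == m)]].

Record abspoly (Z : finType) :=
  AbsPoly { monos :> {fset monomial Z}; _ : antichain monos }.
HB.instance Definition _ (Z : finType) := [isSub for @monos Z].
HB.instance Definition _ (Z : finType) := [Choice of abspoly Z by <:].

Section AbsPoly.
Variable Z : finType.
Implicit Types (m : monomial Z) (S : {fset monomial Z}) (p q r : abspoly Z).

Lemma absorbsP m1 m2 :
  reflect (forall z, enat_le (m1 z) (m2 z)) (absorbs m1 m2).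
Proof. exact: forallP. Qed.

Lemma absorbs_refl : reflexive (@absorbs Z).
Proof. by move=> m; apply/absorbsP => z; apply: enat_le_refl. Qed.

Lemma absorbs_trans : transitive (@absorbs Z).
Proof.
move=> m2 m1 m3 /absorbsP h /absorbsP h'; apply/absorbsP => z.
exact: enat_le_trans (h z) (h' z).
Qed.

Lemma absorbs_anti : antisymmetric (@absorbs Z).
Proof.
move=> m1 m2 /andP[/absorbsP h /absorbsP h']; apply/ffunP => z.
by apply: enat_le_anti; rewrite h h'.
Qed.

Lemma absorbs_add m1 m2 m3 m4 :
  absorbs m1 m3 -> absorbs m2 m4 -> absorbs (m1 + m2) (m3 + m4).
Proof.
move=> /absorbsP h /absorbsP h'; apply/absorbsP => z; rewrite !ffunE.
move: (h z) (h' z).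
by case: (m1 z) (m2 z) (m3 z) (m4 z) => [a|] [b|] [c|] [d|] //=; apply: leq_add.
Qed.

Lemma absorbs_0 m : absorbs 0 m.
Proof. by apply/absorbsP => z; rewrite ffunE; case: (m z). Qed.

Lemma maximals_antichain S : antichain (maximals S).
Proof.
apply/forallP => -[m1 h1]; apply/forallP => -[m2 h2]; apply/implyP => /= h12.
rewrite -val_eqE /=.
move: h1 h2; rewrite !inE /= => /andP[h1 _] /andP[_ /forallP h2].
by have /implyP := h2 [` h1]; apply.
Qed.

Definition maxpoly S : abspoly Z := AbsPoly (maximals_antichain S).

Definition below S m : bool := [exists m' : S, absorbs (val m') m].

Lemma belowP S m :
  reflect (exists2 m', m' \in S & absorbs m' m) (below S m).
Proof.
apply: (iffP existsP) => [[[m' h] h']|[m' h h']]; first by exists m'.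
by exists [` h].
Qed.

Lemma below_trans S m1 m2 : below S m1 -> absorbs m1 m2 -> below S m2.
Proof.
move=> /belowP[m h h1] h2; apply/belowP; exists m => //.
exact: absorbs_trans h1 h2.
Qed.

Lemma below_maximals S m : below (maximals S) m = below S m.
Proof.
apply/belowP/belowP => -[m' hm' h].
  by exists m' => //; move: hm'; rewrite !inE => /andP[].
pose k (x : S) := #|[pred y : S | absorbs (val y) (val x)]|.
have hx0 : absorbs (val [` hm']) m' by apply: absorbs_refl.
case: (@arg_minnP _ [` hm'] (fun x : S => absorbs (val x) m') k hx0).
move=> x hx hmin; exists (val x); last exact: absorbs_trans hx h.
rewrite !inE /= fsvalP /=; apply/forallP => y; apply/implyP => hyx.
apply/eqP; apply: absorbs_anti; rewrite hyx /=.
apply: contraT => hxy.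
have := hmin y (absorbs_trans hyx hx); rewrite leqNgt => /negP; case.
apply: proper_card; apply/properP; split.
  by apply/subsetP => w; rewrite !inE => hw; apply: absorbs_trans hw hyx.
by exists x; rewrite !inE ?absorbs_refl.
Qed.

Lemma antichainP S :
  reflect {in S &, forall m1 m2, absorbs m1 m2 -> m1 = m2} (antichain S).
Proof.
apply: (iffP forallP) => [h m1 m2 h1 h2 h12|h [m1 h1]].
  have /forallP/(_ [` h2])/implyP/(_ h12) := h [` h1].
  by rewrite -val_eqE => /eqP.
apply/forallP => -[m2 h2]; apply/implyP => /= h12.
by rewrite -val_eqE; apply/eqP; apply: h.
Qed.

Lemma abspoly_antichain p :
  {in monos p &, forall m1 m2, absorbs m1 m2 -> m1 = m2}.
Proof. by apply/antichainP; case: p. Qed.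

Lemma below_inj p q : (forall m, below p m = below q m) -> p = q.
Proof.
suff sub p' q' : (forall m, below p' m = below q' m) ->
    {subset monos p' <= monos q'}.
  move=> h; apply: val_inj; apply/fsetP => m.
  by apply/idP/idP; apply: sub => // m'; rewrite h.
move=> h m hm.
have /belowP[m1 h1 h1m] : below q' m.
  by rewrite -h; apply/belowP; exists m; rewrite ?absorbs_refl.
have /belowP[m2 h2 h21] : below p' m1.
  by rewrite h; apply/belowP; exists m1; rewrite ?absorbs_refl.
have e : m2 = m by apply: abspoly_antichain h2 hm (absorbs_trans h21 h1m).
suff -> : m = m1 by [].
by apply: absorbs_anti; rewrite h1m -e h21.
Qed.

Definition abspoly_zero : abspoly Z := maxpoly fset0.
Definition abspoly_mono m : abspoly Z := maxpoly [fset m].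
Definition abspoly_one : abspoly Z := abspoly_mono 0.
Definition abspoly_add p q : abspoly Z := maxpoly (monos p `|` monos q).
Definition abspoly_mul p q : abspoly Z :=
  maxpoly [fset m1 + m2 | m1 in monos p, m2 in monos q].

Lemma below_zero m : below abspoly_zero m = false.
Proof. by rewrite below_maximals; apply/belowP => -[m']; rewrite inE. Qed.

Lemma below_mono m1 m : below (abspoly_mono m1) m = absorbs m1 m.
Proof.
rewrite below_maximals; apply/belowP/idP => [[m' /fset1P -> //]|h].
by exists m1; rewrite ?fset11.
Qed.

Lemma below_add p q m : below (abspoly_add p q) m = below p m || below q m.
Proof.
rewrite below_maximals; apply/belowP/orP => [[m']|].
  by rewrite inE => /orP[] h h'; [left|right]; apply/belowP; exists m'.
by case=> /belowP[m' h h']; exists m'; rewrite // inE h ?orbT.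
Qed.

Lemma below_mulP p q m :
  reflect (exists m1 m2, [/\ below p m1, below q m2 & absorbs (m1 + m2) m])
          (below (abspoly_mul p q) m).
Proof.
rewrite below_maximals; apply: (iffP (belowP _ _)) => [[m']|].
  case/imfset2P => m1 /= h1 [m2 /= h2 ->] h; exists m1, m2; split=> //.
    by apply/belowP; exists m1; rewrite ?absorbs_refl.
  by apply/belowP; exists m2; rewrite ?absorbs_refl.
move=> [m1 [m2 [/belowP[m1' h1 h1'] /belowP[m2' h2 h2'] h]]].
exists (m1' + m2'); first by apply/imfset2P; exists m1' => //; exists m2'.
exact: absorbs_trans (absorbs_add h1' h2') h.
Qed.

Lemma abspoly_addA : associative abspoly_add.
Proof. by move=> p q r; apply: below_inj => m; rewrite !below_add orbA. Qed.

Lemma abspoly_addC : commutative abspoly_add.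
Proof. by move=> p q; apply: below_inj => m; rewrite !below_add orbC. Qed.

Lemma abspoly_add0 : left_id abspoly_zero abspoly_add.
Proof. by move=> p; apply: below_inj => m; rewrite below_add below_zero. Qed.

Lemma abspoly_addpp : idempotent_op abspoly_add.
Proof. by move=> p; apply: below_inj => m; rewrite below_add orbb. Qed.

Lemma abspoly_mulC : commutative abspoly_mul.
Proof.
suff sub p q m : below (abspoly_mul p q) m -> below (abspoly_mul q p) m.
  by move=> p q; apply: below_inj => m; apply/idP/idP; apply: sub.
case/below_mulP => m1 [m2 [h1 h2 h]]; apply/below_mulP.
by exists m2, m1; split; rewrite // addrC.
Qed.

Lemma abspoly_mulA : associative abspoly_mul.
Proof.
move=> p q r; apply: below_inj => m; apply/below_mulP/below_mulP.
  move=> [m1 [m2 [h1 /below_mulP[m3 [m4 [h3 h4 h34]]] h]]].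
  exists (m1 + m3), m4; split=> //.
    by apply/below_mulP; exists m1, m3; rewrite absorbs_refl.
  apply: absorbs_trans h; rewrite -addrA.
  exact: absorbs_add (absorbs_refl _) h34.
move=> [m1 [m2 [/below_mulP[m3 [m4 [h3 h4 h34]]] h2 h]]].
exists m3, (m4 + m2); split=> //.
  by apply/below_mulP; exists m4, m2; rewrite absorbs_refl.
apply: absorbs_trans h; rewrite addrA.
exact: absorbs_add h34 (absorbs_refl _).
Qed.

Lemma abspoly_mul1 : left_id abspoly_one abspoly_mul.
Proof.
move=> p; apply: below_inj => m; apply/below_mulP/idP.
  move=> [m1 [m2 [_ h2 h]]]; apply: below_trans h2 _.
  apply: absorbs_trans h; rewrite -{1}[m2]add0r.
  exact: absorbs_add (absorbs_0 _) (absorbs_refl _).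
move=> h; exists 0, m; rewrite add0r absorbs_refl; split=> //.
by rewrite below_mono absorbs_refl.
Qed.

Lemma abspoly_mulDl : left_distributive abspoly_mul abspoly_add.
Proof.
move=> p q r; apply: below_inj => m; rewrite below_add.
apply/below_mulP/orP => [[m1 [m2 []]]|].
  by rewrite below_add => /orP[] h1 h2 h; [left|right]; apply/below_mulP;
     exists m1, m2.
by case=> /below_mulP[m1 [m2 [h1 h2 h]]]; exists m1, m2; split;
   rewrite // below_add h1 ?orbT.
Qed.

Lemma abspoly_mul0 : left_zero abspoly_zero abspoly_mul.
Proof.
move=> p; apply: below_inj => m; rewrite below_zero.
by apply/below_mulP => -[m1 [m2 []]]; rewrite below_zero.
Qed.

Lemma abspoly_one_neq0 : abspoly_one != abspoly_zero.
Proof.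
apply/eqP => h; have := below_mono 0 0.
by rewrite absorbs_refl -/abspoly_one h below_zero.
Qed.

HB.instance Definition _ := GRing.isNmodule.Build (abspoly Z)
  abspoly_addA abspoly_addC abspoly_add0.
HB.instance Definition _ := GRing.Nmodule_isComNzSemiRing.Build (abspoly Z)
  abspoly_mulA abspoly_mulC abspoly_mul1 abspoly_mulDl abspoly_mul0
  abspoly_one_neq0.

End AbsPoly.

Fact natural_display : Order.disp_t. Proof. exact: Order.Disp tt tt. Qed.

(* The natural order: [a <= b] iff [a + b = b]. *)
Section NaturalOrder.
Variable Z : finType.
Implicit Types p q : abspoly Z.

Definition abspoly_le p q : bool := p + q == q.

Lemma abspoly_le_refl : reflexive abspoly_le.
Proof. by move=> p; apply/eqP; apply: abspoly_addpp. Qed.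
Lemma abspoly_le_anti : antisymmetric abspoly_le.
Proof. by move=> p q /andP[/eqP h /eqP]; rewrite addrC h. Qed.
Lemma abspoly_le_trans : transitive abspoly_le.
Proof. by move=> q p r /eqP h /eqP h'; apply/eqP; rewrite -h' addrA h. Qed.

HB.instance Definition _ := Order.Le_isPOrder.Build natural_display (abspoly Z)
  abspoly_le_refl abspoly_le_anti abspoly_le_trans.

Lemma abspoly_leP p q :
  reflect (forall m, below p m -> below q m) (p <= q)%O.
Proof.
apply: (iffP eqP) => [<- m h|h].
  by apply: etrans (below_add p q m) _; rewrite h.
apply: below_inj => m; apply: etrans (below_add p q m) _.
by apply/orP/idP => [[/h|]|->] //; right.
Qed.

End NaturalOrder.

Section Evaluation.
Variable W : finType.
Implicit Types a c g : abspoly W.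

Definition is_glb (s : nat -> abspoly W) g : Prop :=
  (forall n, (g <= s n)%O) /\ (forall c, (forall n, (c <= s n)%O) -> (c <= g)%O).

Definition mono_inf (m : monomial W) : monomial W :=
  [ffun z => if m z == 0 then 0 else (None : enat)].

Lemma mono_inf_absorbed (m : monomial W) n : absorbs (m *+ n) (mono_inf m).
Proof.
apply/absorbsP => z; rewrite ffunMnE ffunE.
by case: eqP => [->|_]; [rewrite mul0rn|case: (m z *+ n)].
Qed.

Lemma below_exp a m n : below a m -> below (a ^+ n) (m *+ n).
Proof.
move=> h; elim: n => [|n IH].
  by rewrite [below _ _]below_mono absorbs_0.
by rewrite exprS mulrS; apply/below_mulP; exists m, (m *+ n);
   rewrite absorbs_refl.
Qed.

Definition weight (F : pred W) (m : monomial W) : nat :=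
  (\sum_(z | F z) odflt 0 (m z : option nat))%N.

Lemma weight_exp a (k : monomial W) n m :
    (forall m', m' \in monos a -> ~~ absorbs (mono_inf m') k) ->
    below (a ^+ n) m -> absorbs m k -> (n <= weight (isSome \o k) m)%N.
Proof.
move=> hk; elim: n m => [//|n IH] m.
rewrite exprS => /below_mulP[m1 [m2 [/belowP[m1' ha h11] h2 h12]]] hm.
have hm2 : absorbs m2 k.
  apply: absorbs_trans (absorbs_trans h12 hm); rewrite -{1}[m2]add0r.
  exact: absorbs_add (absorbs_0 _) (absorbs_refl _).
have := IH _ h2 hm2.
have /forallPn[z hz] := hk _ ha.
have Fz : isSome (k z) by case: (k z) hz => // ; rewrite ffunE; case: ifP.
have nz : m1' z != 0 by move: hz; rewrite ffunE; case: ifP => // _; case: (k z).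
move=> h; rewrite /weight (bigD1 z) //=.
move: h; rewrite /weight (bigD1 z) //= => h.
have dom y : isSome (k y) ->
    (odflt 0 (m1' y : option nat) + odflt 0 (m2 y : option nat)
       <= odflt 0 (m y : option nat))%N
    /\ m1' y <> None.
  move=> Fy; have /absorbsP/(_ y) := h12; have /absorbsP/(_ y) := h11.
  have /absorbsP/(_ y) := hm; rewrite ffunE.
  case: (k y) Fy (m y) (m1' y) (m1 y) (m2 y) => // e _ [i|] [j|] [l|] [o|] //=.
  by move=> ? ? ?; split=> //; lia.
have [d1 d2] := dom z Fz.
have {}nz : (0 < odflt 0 (m1' z : option nat))%N.
  by case: (m1' z) nz d2 => [[|i]|].
have le2 : (\sum_(i | isSome (k i) && (i != z)) odflt 0 (m2 i : option nat)
  <= \sum_(i | isSome (k i) && (i != z)) odflt 0 (m i : option nat))%N.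
  by apply: leq_sum => i /andP[/dom[d _] _]; lia.
by lia.
Qed.

Lemma inf_powers (a : abspoly W) : {g | is_glb (fun n => a ^+ n) g}.
Proof.
exists (maxpoly [fset mono_inf m | m in monos a]); split=> [n|c hc].
  apply/abspoly_leP => m; rewrite below_maximals => /belowP[m'].
  case/imfsetP => m1 /= h1 -> h; apply: below_trans h.
  apply: below_trans (mono_inf_absorbed m1 n); apply: below_exp.
  by apply/belowP; exists m1; rewrite ?absorbs_refl.
apply/abspoly_leP => k hk; rewrite below_maximals; apply/belowP.
have [/existsP[[m hm] h]|/existsPn hno] :=
  boolP [exists m : monos a, absorbs (mono_inf (val m)) k].
  by exists (mono_inf m) => //; apply/imfsetP; exists m.
have hno' m' : m' \in monos a -> ~~ absorbs (mono_inf m') k.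
  by move=> h; apply: (hno [` h]).
have hb : below (a ^+ (weight (isSome \o k) k).+1) k.
  by have /abspoly_leP := hc (weight (isSome \o k) k).+1; apply.
by have := weight_exp hno' hb (absorbs_refl k); rewrite ltnn.
Qed.

(* [a ^ oo] is the infimum of the powers [a ^+ n]. *)
Definition expinf (a : abspoly W) : abspoly W := sval (inf_powers a).

Lemma expinfP a : is_glb (fun n => a ^+ n) (expinf a).
Proof. exact: svalP. Qed.

Definition exp_enat (a : abspoly W) (e : enat) : abspoly W :=
  if e is Some n then a ^+ n else expinf a.

(* The value of [p] under the homomorphic extension of the assignment [h]. *)
Definition eval (Z : finType) (h : Z -> abspoly W) (p : abspoly Z) :
    abspoly W :=
  \sum_(m <- monos p) \prod_z exp_enat (h z) (m z).

End Evaluation.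

Definition indet (Z : finType) (z : Z) : abspoly Z :=
  abspoly_mono [ffun z' => Some (nat_of_bool (z' == z))].

(* [option Z] is [Z] extended with one fresh indeterminate, [None].  The      *)
(* substitution [p(x)] replaces [None] by [x], keeping those of [Z].          *)
Definition subst (Z : finType) (p : abspoly (option Z)) (x : abspoly Z) :
    abspoly Z :=
  eval (fun z : option Z => if z is Some z' then indet z' else x) p.

(* [option (option A)] is [A] with two fresh indeterminates: [None] is X and  *)
(* [Some None] is Y, so that [option A] is [A] together with Y.               *)
Definition subst2 (A : finType) (p : abspoly (option (option A)))
    (x y : abspoly A) : abspoly A :=
  eval (fun z : option (option A) =>
          match z with
          | None => x
          | Some None => y
          | Some (Some a) => indet a
          end) p.

Definition greatest_solution (d : Order.disp_t) (T : porderType d)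
    (F : T -> T) (x : T) : Prop :=
  x = F x /\ forall y, y = F y -> (y <= x)%O.

(* The operator of the system X = P(X,Y), Y = Q(X,Y); pairs of elements are   *)
(* ordered componentwise.                                                     *)
Definition system (A : finType) (P Q : abspoly (option (option A)))
    (xy : abspoly A *p abspoly A) : abspoly A *p abspoly A :=
  (subst2 P xy.1 xy.2, subst2 Q xy.1 xy.2).

(* Main.v *)
(* Absorption gives x^e <= x for every exponent e <> 0.  Hence, collecting the
   monomials of R(X) without X into c and the coefficients of the remaining
   ones into d, every x with x <= R(x) satisfies x <= c + d x, so by iteration
   x <= c + d^n for all n, i.e. x <= c + d^oo; and c + d^oo is itself a
   solution of X = R(X).  Thus the greatest solution is the closed form
   c + d^oo, which is preserved by every evaluation: if H is the greatest
   solution of X = P(X,Y), then x <= P(x,y) implies x <= H(y).  For a solution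
   (x,y) of the system this gives y = Q(x,y) <= Q(H(y),y), and the same bound
   for the equation Y = Q(H(Y),Y) gives y <= b, so that x <= H(y) <= H(b). *)
Require Import Defs.
From mathcomp Require Import all_boot all_order all_algebra.
From mathcomp Require Import finmap.
Set Implicit Arguments.
Unset Strict Implicit.
Unset Printing Implicit Defensive.

Import Order.TTheory GRing.Theory.
Local Open Scope fset_scope.
Local Open Scope ring_scope.

(** * Addition as join, and monotonicity of the operations *)

Section Order.
Variable Z : finType.
Implicit Types (p q r s : abspoly Z) (m k : monomial Z).

Lemma belowD p q m : below (p + q) m = below p m || below q m.
Proof. exact: below_add. Qed.

Lemma belowMP p q m :
  reflect (exists m1 m2, [/\ below p m1, below q m2 & absorbs (m1 + m2) m])
          (below (p * q) m).
Proof. exact: below_mulP. Qed.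

Lemma below_mem p m : m \in monos p -> below p m.
Proof. by move=> h; apply/belowP; exists m => //; apply: absorbs_refl. Qed.

Lemma abspoly_le_addl p q : (p <= p + q)%O.
Proof. by apply/abspoly_leP => m h; rewrite belowD h. Qed.

Lemma abspoly_le_addr p q : (q <= p + q)%O.
Proof. by rewrite addrC; apply: abspoly_le_addl. Qed.

Lemma abspoly_le_add p q r : (p + q <= r)%O = (p <= r)%O && (q <= r)%O.
Proof.
apply/idP/andP => [h|[/abspoly_leP hp /abspoly_leP hq]].
  by split; apply: le_trans h; [apply: abspoly_le_addl|apply: abspoly_le_addr].
by apply/abspoly_leP => m; rewrite belowD => /orP[/hp|/hq].
Qed.

Lemma abspoly_leD p q r s : (p <= q)%O -> (r <= s)%O -> (p + r <= q + s)%O.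
Proof.
move=> hpq hrs; rewrite abspoly_le_add.
rewrite (le_trans hpq (abspoly_le_addl _ _)).
exact: le_trans hrs (abspoly_le_addr _ _).
Qed.

Lemma abspoly_leM p q r s : (p <= q)%O -> (r <= s)%O -> (p * r <= q * s)%O.
Proof.
move=> /abspoly_leP hpq /abspoly_leP hrs; apply/abspoly_leP => m.
move=> /belowMP[m1 [m2 [/hpq h1 /hrs h2 h]]].
by apply/belowMP; exists m1, m2.
Qed.

Lemma abspoly_ge0 p : ((0 : abspoly Z) <= p)%O.
Proof. by apply/eqP; apply: add0r. Qed.

(** The monomial 1 absorbs every monomial; this is where absorptivity enters. *)
Lemma abspoly_le1 p : (p <= (1 : abspoly Z))%O.
Proof.
apply/abspoly_leP => m _.
by rewrite [below _ _]below_mono absorbs_0.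
Qed.

Lemma abspoly_mull_le p q : (p * q <= q)%O.
Proof. by rewrite -[leRHS]mul1r; apply: abspoly_leM (abspoly_le1 _) _. Qed.

Lemma abspoly_le_sum (I : eqType) (r : seq I) (P : pred I)
    (F : I -> abspoly Z) q :
  (\sum_(i <- r | P i) F i <= q)%O <->
  (forall i, i \in r -> P i -> (F i <= q)%O).
Proof.
elim: r => [|i r IH]; first by rewrite big_nil; split=> // _; apply: abspoly_ge0.
rewrite big_cons; split=> [h j|h].
  rewrite inE => /predU1P[->|jr] Pj.
    by move: h; rewrite Pj abspoly_le_add => /andP[].
  apply: (proj1 IH) => //; move: h.
  by case: ifP => // _; rewrite abspoly_le_add => /andP[].
have hr : (\sum_(j <- r | P j) F j <= q)%O.
  by apply/IH => j jr; apply: h; rewrite inE jr orbT.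
case: ifP => // Pi; rewrite abspoly_le_add hr andbT.
by apply: h => //; rewrite inE eqxx.
Qed.

Lemma abspoly_le_term (I : eqType) (r : seq I) (P : pred I)
    (F : I -> abspoly Z) i :
  i \in r -> P i -> (F i <= \sum_(i <- r | P i) F i)%O.
Proof. by have [h _] := abspoly_le_sum r P F (\sum_(i <- r | P i) F i);
  apply: h. Qed.

Lemma abspoly_le_prod (I : finType) (F G : I -> abspoly Z) :
  (forall i, (F i <= G i)%O) -> (\prod_i F i <= \prod_i G i)%O.
Proof.
by move=> h; elim/big_ind2: _ => // p q r s; apply: abspoly_leM.
Qed.

Lemma abspoly_leX p q n : (p <= q)%O -> (p ^+ n <= q ^+ n)%O.
Proof.
move=> h; elim: n => [//|n IH]; rewrite !exprS.
exact: abspoly_leM.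
Qed.

(** Turns [below] into an inequality, so that universal properties such as that of [expinf] apply to
    single monomials. *)
Lemma le_abspoly_mono m p : (abspoly_mono m <= p)%O = below p m.
Proof.
apply/abspoly_leP/idP => [|h k]; first by apply; rewrite below_mono absorbs_refl.
by rewrite below_mono; apply: below_trans.
Qed.

Lemma abspoly_sum_mono p : \sum_(m <- monos p) abspoly_mono m = p.
Proof.
apply/le_anti/andP; split.
  by apply/abspoly_le_sum => m h _; rewrite le_abspoly_mono below_mem.
apply/abspoly_leP => k /belowP[m hm hmk]; rewrite -le_abspoly_mono.
apply: le_trans (abspoly_le_term (P := predT) _ hm isT).
by rewrite le_abspoly_mono below_mono.
Qed.

Lemma abspoly_monoD m k :
  abspoly_mono (m + k) = abspoly_mono m * abspoly_mono k.
Proof.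
apply: below_inj => l; rewrite below_mono; apply/idP/belowMP => [h|].
  by exists m, k; rewrite !below_mono !absorbs_refl.
move=> [m1 [m2 []]]; rewrite !below_mono => h1 h2.
by apply: absorbs_trans; apply: absorbs_add.
Qed.

End Order.

(** * Infinite powers *)

Section InfinitePower.
Variable Z : finType.
Implicit Types (a b p : abspoly Z) (m k : monomial Z) (e f : enat).

Lemma mono_infD m k : mono_inf (m + k) = mono_inf m + mono_inf k.
Proof. by apply/ffunP => z; rewrite !ffunE; case: (m z) (k z) => [[|i]|] [[|j]|]. Qed.

Lemma mono_infDl m : m + mono_inf m = mono_inf m.
Proof. by apply/ffunP => z; rewrite !ffunE; case: (m z) => [[|i]|]. Qed.

Lemma mono_inf_idem m : mono_inf (mono_inf m) = mono_inf m.
Proof. by apply/ffunP => z; rewrite !ffunE; case: (m z) => [[|i]|]. Qed.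

Lemma absorbs_mono_inf m k : absorbs m k -> absorbs (mono_inf m) (mono_inf k).
Proof.
move=> /absorbsP h; apply/absorbsP => z; move: (h z); rewrite !ffunE.
by case: (m z) (k z) => [[|i]|] [[|j]|].
Qed.

(** If no [mono_inf m] with [m] in [a] absorbs [k], then every factor of a product from [a ^+ n]
    absorbing [k] has a positive exponent at some place where [k] is finite; so [n] is at most the
    sum of the finite exponents of [k]. *)
Lemma below_expinfP a k :
  reflect (exists2 m, below a m & absorbs (mono_inf m) k) (below (expinf a) k).
Proof.
have [lb glb] := expinfP a.
apply: (iffP idP) => [h|[m hm h]]; last first.
  apply: below_trans h; rewrite -le_abspoly_mono; apply: glb => n.
  rewrite le_abspoly_mono; apply: below_trans (mono_inf_absorbed m n).
  exact: below_exp.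
case: (boolP [exists m : monos a, absorbs (mono_inf (val m)) k]).
  by move=> /existsP[m hm]; exists (val m) => //; apply/below_mem/valP.
move=> /existsPn hno.
have hno' m : m \in monos a -> ~~ absorbs (mono_inf m) k.
  by move=> hm; apply: (hno [` hm]).
(* A power one larger than that sum gives the contradiction. *)
have /abspoly_leP/(_ _ h) hk := lb (weight (isSome \o k) k).+1.
by have := weight_exp hno' hk (absorbs_refl k); rewrite ltnn.
Qed.

Lemma expinf_leX a n : (expinf a <= a ^+ n)%O.
Proof. by have [] := expinfP a. Qed.

Lemma expinf_le a b : (a <= b)%O -> (expinf a <= expinf b)%O.
Proof.
move=> /abspoly_leP h; apply/abspoly_leP => k /below_expinfP[m /h hm hk].
by apply/below_expinfP; exists m.
Qed.

Lemma expinf_mono m : expinf (abspoly_mono m) = abspoly_mono (mono_inf m).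
Proof.
apply: below_inj => k; rewrite below_mono; apply/below_expinfP/idP => [[l]|h].
  by rewrite below_mono => /absorbs_mono_inf; apply: absorbs_trans.
by exists m; rewrite // below_mono absorbs_refl.
Qed.

(** Unlike for finite powers, there are no cross terms: a monomial of an infinite power comes from a
    single monomial of the base. *)
Lemma expinfD a b : expinf (a + b) = expinf a + expinf b.
Proof.
apply: below_inj => k; rewrite belowD; apply/below_expinfP/orP => [[m]|].
  by rewrite belowD => /orP[] hm h; [left|right]; apply/below_expinfP; exists m.
by case=> /below_expinfP[m hm h]; exists m; rewrite // belowD hm ?orbT.
Qed.

Lemma expinf0 : expinf (0 : abspoly Z) = 0.
Proof.
apply/le_anti; rewrite abspoly_ge0 andbT; exact: (expinf_leX 0 1).
Qed.

Lemma expinfM a b : expinf (a * b) = expinf a * expinf b.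
Proof.
apply: below_inj => k; apply/below_expinfP/belowMP.
  move=> [m /belowMP[m1 [m2 [h1 h2 h]]] hk]; exists (mono_inf m1), (mono_inf m2).
  split.
  - by apply/below_expinfP; exists m1; rewrite ?absorbs_refl.
  - by apply/below_expinfP; exists m2; rewrite ?absorbs_refl.
  - by rewrite -mono_infD; apply: absorbs_trans hk; apply: absorbs_mono_inf.
move=> [k1 [k2 [/below_expinfP[m1 h1 hk1] /below_expinfP[m2 h2 hk2] h]]].
exists (m1 + m2); first by apply/belowMP; exists m1, m2; rewrite absorbs_refl.
by rewrite mono_infD; apply: absorbs_trans h; apply: absorbs_add.
Qed.

Lemma expinf1 : expinf (1 : abspoly Z) = 1.
Proof.
apply/le_anti; rewrite abspoly_le1 /=.
by have [_] := expinfP (1 : abspoly Z); apply=> n; rewrite expr1n.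
Qed.

Lemma mul_expinf a : a * expinf a = expinf a.
Proof.
apply/le_anti; rewrite abspoly_mull_le /=.
apply/abspoly_leP => k /below_expinfP[m hm h].
apply/belowMP; exists m, (mono_inf m); rewrite mono_infDl; split=> //.
by apply/below_expinfP; exists m => //; apply: absorbs_refl.
Qed.

Lemma expinf_idem a : expinf (expinf a) = expinf a.
Proof.
apply/le_anti/andP; split.
  by rewrite -[leRHS]expr1; apply: expinf_leX.
apply/abspoly_leP => k /below_expinfP[m hm h].
apply/below_expinfP; exists (mono_inf m); rewrite ?mono_inf_idem //.
by apply/below_expinfP; exists m => //; apply: absorbs_refl.
Qed.

Lemma expinf_mul a : expinf a * expinf a = expinf a.
Proof. by rewrite -{1}[expinf a]expinf_idem mulrC mul_expinf expinf_idem. Qed.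

Lemma exp_enatD a e f : exp_enat a (e + f) = exp_enat a e * exp_enat a f.
Proof.
have absorb n : a ^+ n * expinf a = expinf a.
  by elim: n => [|n IH]; rewrite ?mul1r // exprSr -mulrA mul_expinf.
case: e f => [i|] [j|] /=; first exact: exprD.
- by rewrite absorb.
- by rewrite mulrC absorb.
- by rewrite expinf_mul.
Qed.

(** By absorption, powers decrease as the exponent grows. *)
Lemma exp_enat_le a b e f :
  (a <= b)%O -> enat_le f e -> (exp_enat a e <= exp_enat b f)%O.
Proof.
move=> hab; case: e f => [i|] [j|]; rewrite /exp_enat => hfe.
- rewrite -(subnK (hfe : (j <= i)%N)) exprD.
  by apply: le_trans (abspoly_mull_le _ _) (abspoly_leX _ hab).
- by [].
- exact: le_trans (expinf_leX a j) (abspoly_leX _ hab).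
- exact: expinf_le.
Qed.

(** The exponents change as under [mono_inf]: 0 stays, because the infinite power of 1 is 1, and any
    other exponent becomes oo. *)
Lemma expinf_exp_enat a e :
  expinf (exp_enat a e) = exp_enat a (if e == 0 then 0 else (None : enat)).
Proof.
case: e => [n|] /=; last exact: expinf_idem.
elim: n => [|n IH]; first by rewrite expinf1.
rewrite exprS expinfM {}IH; case: n => [|n] /=; first exact: mulr1.
exact: expinf_mul.
Qed.

Lemma exp_enat_expinf a e : e != 0 -> exp_enat (expinf a) e = expinf a.
Proof.
case: e => [[|n]|]; rewrite /exp_enat => ne0; last exact: expinf_idem.
  by rewrite eqxx in ne0.
elim: n {ne0} => [|n IH]; first exact: expr1.
by rewrite exprS IH expinf_mul.
Qed.

Lemma exp_enat_mono (m : monomial Z) e :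
  exp_enat (abspoly_mono m) e =
  abspoly_mono (if e is Some n then m *+ n else mono_inf m).
Proof.
case: e => [n|] /=; last exact: expinf_mono.
by elim: n => [//|n IH]; rewrite exprS IH mulrS abspoly_monoD.
Qed.

End InfinitePower.

(** * Evaluation as a homomorphism compatible with infinite powers *)

Section EvalMorphism.
Variables Z W : finType.
Implicit Types (h : Z -> abspoly W) (p q : abspoly Z) (m k : monomial Z).

Definition term h m : abspoly W := \prod_z exp_enat (h z) (m z).

Lemma termD h m k : term h (m + k) = term h m * term h k.
Proof.
by rewrite -big_split; apply: eq_bigr => z _; rewrite ffunE exp_enatD.
Qed.

Lemma term0 h : term h 0 = 1.
Proof. by apply: big1 => z _; rewrite ffunE. Qed.

Lemma term_indet h z :
  term h [ffun z' => Some (nat_of_bool (z' == z))] = h z.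
Proof.
rewrite /term (bigD1 z) //= ffunE eqxx big1 ?mulr1 // => z' /negPf hz.
by rewrite ffunE hz.
Qed.

Lemma term_le h g m k :
  (forall z, (h z <= g z)%O) -> absorbs k m -> (term h m <= term g k)%O.
Proof.
by move=> hg /absorbsP hk; apply: abspoly_le_prod => z; apply: exp_enat_le.
Qed.

Lemma expinf_prod (I : finType) (F : I -> abspoly W) :
  expinf (\prod_i F i) = \prod_i expinf (F i).
Proof. exact: (big_morph _ (@expinfM W) (@expinf1 W)). Qed.

Lemma expinf_term h m : expinf (term h m) = term h (mono_inf m).
Proof.
by rewrite expinf_prod; apply: eq_bigr => z _; rewrite expinf_exp_enat ffunE.
Qed.

(** Since [term] respects absorption, evaluation is the join over all monomials below [p], not only
    the maximal ones. The restriction to maximal monomials in sums and products thus does no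
    harm. *)
Lemma eval_leP h p (q : abspoly W) :
  (eval h p <= q)%O <-> (forall m, below p m -> (term h m <= q)%O).
Proof.
split=> [hp m /belowP[k hk hkm]|hp].
  apply: le_trans (term_le (fun z => lexx (h z)) hkm) _.
  by move/abspoly_le_sum: hp; apply.
by apply/abspoly_le_sum => m hm _; apply/hp/below_mem.
Qed.

Lemma le_term_eval h p m : below p m -> (term h m <= eval h p)%O.
Proof. by have [+ _] := eval_leP h p (eval h p); apply. Qed.

Lemma eval_le h g p q :
  (forall z, (h z <= g z)%O) -> (p <= q)%O -> (eval h p <= eval g q)%O.
Proof.
move=> hg /abspoly_leP hpq; apply/eval_leP => m /hpq hm.
exact: le_trans (term_le hg (absorbs_refl m)) (le_term_eval _ hm).
Qed.

Lemma eq_eval h g p : h =1 g -> eval h p = eval g p.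
Proof.
by move=> hg; apply: eq_bigr => m _; apply: eq_bigr => z _; rewrite hg.
Qed.

Lemma eval0 h : eval h 0 = 0.
Proof.
apply/le_anti; rewrite abspoly_ge0 andbT; apply/eval_leP => m.
by rewrite [below _ _]below_zero.
Qed.

Lemma evalD h p q : eval h (p + q) = eval h p + eval h q.
Proof.
apply/le_anti/andP; split; last first.
  rewrite abspoly_le_add; apply/andP.
  split; apply: eval_le (fun z => lexx (h z)) _.
    exact: abspoly_le_addl.
  exact: abspoly_le_addr.
apply/eval_leP => m; rewrite belowD => /orP[] /(le_term_eval h) /le_trans; apply.
  exact: abspoly_le_addl.
exact: abspoly_le_addr.
Qed.

Lemma eval_mono h m : eval h (abspoly_mono m) = term h m.
Proof.
apply/le_anti; rewrite le_term_eval ?below_mono ?absorbs_refl // andbT.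
by apply/eval_leP => k; rewrite below_mono; apply: term_le.
Qed.

Lemma eval_indet h z : eval h (indet z) = h z.
Proof. by rewrite eval_mono term_indet. Qed.

Lemma eval1 h : eval h 1 = 1.
Proof. by rewrite eval_mono term0. Qed.

Lemma evalM h p q : eval h (p * q) = eval h p * eval h q.
Proof.
apply/le_anti/andP; split.
  apply/eval_leP => m /belowMP[m1 [m2 [h1 h2 hm]]].
  apply: le_trans (term_le (fun z => lexx (h z)) hm) _.
  by rewrite termD; apply: abspoly_leM; apply: le_term_eval.
rewrite {1 2}/eval big_distrl; apply/abspoly_le_sum => m1 h1 _ /=.
rewrite big_distrr; apply/abspoly_le_sum => m2 h2 _ /=.
rewrite -[_ * _]/(term h m1 * term h m2) -termD; apply: le_term_eval.
by apply/belowMP; exists m1, m2; rewrite !below_mem ?absorbs_refl.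
Qed.

(** Both bounds reduce to single terms, whose infinite powers are given by [mono_inf]; for the
    second, [expinfD] first distributes the infinite power over the sum. This carries the closed
    form through substitutions. *)
Lemma eval_expinf h p : eval h (expinf p) = expinf (eval h p).
Proof.
apply/le_anti/andP; split.
  apply/eval_leP => k /below_expinfP[m hm hk].
  apply: le_trans (term_le (fun z => lexx (h z)) hk) _.
  by rewrite -expinf_term; apply/expinf_le/le_term_eval.
rewrite {1}/eval (big_morph _ (@expinfD W) (@expinf0 W)).
apply/abspoly_le_sum => m hm _.
rewrite [leLHS]expinf_term; apply: le_term_eval.
by apply/below_expinfP; exists m; rewrite ?below_mem ?absorbs_refl.
Qed.

Lemma eval_exp_enat h p e : eval h (exp_enat p e) = exp_enat (eval h p) e.
Proof.
case: e => [n|] /=; last exact: eval_expinf.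
by elim: n => [|n IH]; rewrite ?eval1 // !exprS evalM IH.
Qed.

End EvalMorphism.

(** * Composition of evaluations and the identity assignment *)

Lemma eval_term (Z W V : finType) (h : W -> abspoly V) (g : Z -> abspoly W) m :
  eval h (term g m) = term (fun z => eval h (g z)) m.
Proof.
rewrite /term (big_morph _ (evalM h) (eval1 h)).
by apply: eq_bigr => z _; apply: eval_exp_enat.
Qed.

Lemma eval_eval (Z W V : finType) (h : W -> abspoly V) (g : Z -> abspoly W) p :
  eval h (eval g p) = eval (fun z => eval h (g z)) p.
Proof.
rewrite {2}/eval (big_morph _ (evalD h) (eval0 h)).
by apply: eq_bigr => m _; apply: eval_term.
Qed.

Lemma term_indets (Z : finType) (m : monomial Z) :
  term (@indet Z) m = abspoly_mono m.
Proof.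
(* The power of [z] that occurs in [m]. *)
pose single z : monomial Z := [ffun z' => if z' == z then m z else 0].
have indetX z : exp_enat (indet z) (m z) = abspoly_mono (single z).
  rewrite exp_enat_mono; congr abspoly_mono; apply/ffunP => z'.
  rewrite [RHS]ffunE; case: (m z) => [n|]; rewrite ?ffunMnE !ffunE.
    case: eqP => _ /=; last by rewrite mul0rn.
    by elim: n => [//|n IH]; rewrite mulrS IH.
  by case: (z' == z).
rewrite /term (eq_bigr _ (fun z _ => indetX z)).
rewrite -(big_morph _ (@abspoly_monoD Z) (erefl : abspoly_mono 0 = 1)).
congr abspoly_mono; apply/ffunP => z; rewrite sum_ffunE (bigD1 z) //=.
rewrite ffunE eqxx big1 ?addr0 // => z' /negPf hz.
by rewrite ffunE eq_sym hz.
Qed.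

Lemma eval_indets (Z : finType) (p : abspoly Z) : eval (@indet Z) p = p.
Proof.
rewrite -[RHS]abspoly_sum_mono; apply: eq_bigr => m _; exact: term_indets.
Qed.

(** * Closed form of the greatest solution of one equation *)

Section GreatestSolution.
Variable Z : finType.
Implicit Types (R H : abspoly (option Z)).

(** With [indet] for [h], evaluation under this assignment is [subst] by conversion; a general [h]
    evaluates the coefficients as well. *)
Definition extend (W : finType) (h : Z -> abspoly W) (x : abspoly W)
    (z : option Z) : abspoly W :=
  if z is Some z' then h z' else x.

Definition coefficient (m : monomial (option Z)) : monomial Z :=
  [ffun z => m (Some z)].

Lemma term_extend (W : finType) (h : Z -> abspoly W) x m :
  term (extend h x) m = exp_enat x (m None) * term h (coefficient m).
Proof.
rewrite /term (bigD1 None) //=; congr (_ * _).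
rewrite (reindex_omap Some id) => [|[]//] /=.
by apply: eq_big => [z|z _]; rewrite ?eqxx // ffunE.
Qed.

Definition constant_part R : abspoly Z :=
  \sum_(m <- monos R | m None == 0) abspoly_mono (coefficient m).

(** Every nonzero exponent of the fresh indeterminate, oo included, is treated as if it were 1. *)
Definition linear_part R : abspoly Z :=
  \sum_(m <- monos R | m None != 0) abspoly_mono (coefficient m).

Lemma eval_constant_part (W : finType) (h : Z -> abspoly W) R :
  eval h (constant_part R) =
  \sum_(m <- monos R | m None == 0) term h (coefficient m).
Proof.
rewrite (big_morph _ (evalD h) (eval0 h)).
by apply: eq_bigr => m _; apply: eval_mono.
Qed.

Lemma eval_linear_part (W : finType) (h : Z -> abspoly W) R :
  eval h (linear_part R) =
  \sum_(m <- monos R | m None != 0) term h (coefficient m).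
Proof.
rewrite (big_morph _ (evalD h) (eval0 h)).
by apply: eq_bigr => m _; apply: eval_mono.
Qed.

Lemma eval_extend_le (W : finType) (h : Z -> abspoly W) x R :
  (eval (extend h x) R <=
   eval h (constant_part R) + eval h (linear_part R) * x)%O.
Proof.
rewrite eval_constant_part eval_linear_part.
apply/abspoly_le_sum => m hm _; rewrite [leLHS]term_extend.
have [e0|ne0] := eqVneq (m None) 0.
  rewrite e0 mul1r; apply: le_trans (abspoly_le_addl _ _).
  by apply: (abspoly_le_term (fun k => term h (coefficient k))) => //; apply/eqP.
apply: le_trans (abspoly_le_addr _ _); rewrite mulrC; apply: abspoly_leM.
  exact: (abspoly_le_term (fun k => term h (coefficient k))).
(* Among the nonzero exponents, 1 is the least and so gives the largest power of [x]. *)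
apply: (@exp_enat_le _ x x (m None) (Some 1%N)) => //.
by case: (m None) ne0 => [[|n]|].
Qed.

(** Stated for an arbitrary assignment [h], so that the closed form still bounds [x] after its
    coefficients are evaluated. *)
Lemma post_fixpoint_le (W : finType) (h : Z -> abspoly W) x R :
  (x <= eval (extend h x) R)%O ->
  (x <= eval h (constant_part R + expinf (linear_part R)))%O.
Proof.
rewrite evalD eval_expinf => /le_trans/(_ (eval_extend_le h x R)).
move: (eval h (constant_part R)) (eval h (linear_part R)) => c d hx.
have iter n : (x <= c + d ^+ n)%O.
  elim: n => [|n IH].
    (* [d ^+ 0] is 1, the top element. *)
    exact: le_trans (abspoly_le1 x) (abspoly_le_addr _ _).
  apply: le_trans hx _; rewrite abspoly_le_add; apply/andP.
  split; first exact: abspoly_le_addl.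
  apply: le_trans (abspoly_leM (lexx d) IH) _.
  rewrite mulrDr -exprS.
  exact: abspoly_leD (abspoly_mull_le d c) (lexx (d ^+ n.+1)).
(* Passage to the infimum, one monomial at a time: a monomial of [x] that is not in [c] is in every
   [d ^+ n], hence in [expinf d]. *)
apply/abspoly_leP => k hk; rewrite belowD.
have [//|nck] := boolP (below c k).
rewrite -le_abspoly_mono; have [_] := expinfP d; apply=> n.
have /abspoly_leP/(_ _ hk) := iter n.
by rewrite belowD (negPf nck) le_abspoly_mono.
Qed.

Lemma subst_le R (x y : abspoly Z) : (x <= y)%O -> (subst R x <= subst R y)%O.
Proof. by move=> hxy; apply: eval_le => // -[]. Qed.

(** It is enough that g <= R(g): by monotonicity R(g) is then a post-fixed point too, and all of
    these lie below g. *)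
Lemma closed_form_fixpoint R :
  constant_part R + expinf (linear_part R) =
  subst R (constant_part R + expinf (linear_part R)).
Proof.
set g := _ + _; have post (x : abspoly Z) : (x <= subst R x)%O -> (x <= g)%O.
  by move=> /post_fixpoint_le; rewrite eval_indets.
have coef m : m \in monos R ->
    (exp_enat g (m None) * abspoly_mono (coefficient m) <= subst R g)%O.
  move=> hm; rewrite -term_indets -term_extend.
  exact: le_term_eval (below_mem hm).
suff hg : (g <= subst R g)%O.
  by apply/le_anti/andP; split=> //; apply/post/subst_le.
rewrite {1}/g abspoly_le_add; apply/andP; split.
  apply/abspoly_le_sum => m hm /eqP m0.
  by have := coef m hm; rewrite m0 mul1r.
(* One factor d split off d^oo supplies the coefficient of a monomial of R; the remaining d^oo
   equals (d^oo)^e for e nonzero, and so is at most g^e. *)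
rewrite -mul_expinf {1}/linear_part big_distrl.
apply/abspoly_le_sum => m hm ne0 /=; apply: le_trans (coef m hm).
rewrite mulrC; apply: abspoly_leM => //.
rewrite -(exp_enat_expinf (linear_part R) ne0).
apply: exp_enat_le; first exact: abspoly_le_addr.
exact: enat_le_refl.
Qed.

(** The closed form is a solution, hence at most [y], and evaluation is monotone. *)
Lemma greatest_solution_eval (W : finType) (h : Z -> abspoly W) x R y :
  greatest_solution (subst R) y -> (x <= eval (extend h x) R)%O ->
  (x <= eval h y)%O.
Proof.
move=> [_ hy] /post_fixpoint_le /le_trans; apply.
exact/eval_le/hy/closed_form_fixpoint.
Qed.

End GreatestSolution.

(** * Elimination of X from the system *)

Lemma subst_subst (A : finType) (P : abspoly (option (option A)))
    (H : abspoly (option A)) (b : abspoly A) :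
  subst (subst P H) b = subst2 P (subst H b) b.
Proof.
(* Both assignments send X to H(b), Y to b and fix the other indeterminates. *)
rewrite /subst eval_eval; apply: eq_eval => -[z|] //.
by rewrite eval_indet; case: z.
Qed.

Theorem theorem35 (A : finType) (P Q : abspoly (option (option A)))
    (H : abspoly (option A)) (b : abspoly A) :
  greatest_solution (subst P) H ->
  greatest_solution (subst (subst Q H)) b ->
  greatest_solution (system P Q) (subst H b, b).
Proof.
move=> solH solb; split.
  rewrite /system /= -!subst_subst -(proj1 solH).
  by rewrite -(proj1 solb).
move=> [x y] [ex ey].
(* P is regarded as a polynomial in X alone, with its coefficients evaluated at Y = y. *)
have ext u : subst2 P u y = eval (extend (extend (@indet A) y) u) P.
  by apply: eq_eval => -[[]|].
have hx : (x <= subst H y)%O.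
  by apply: greatest_solution_eval solH _; rewrite -[leRHS]ext -ex.
have hy : (y <= b)%O.
  (* The bound is used with the identity assignment; y need only be a post-fixed point, which
     follows from y = Q(x,y) <= Q(H(y),y). *)
  rewrite -[leRHS]eval_indets; apply: greatest_solution_eval solb _.
  rewrite -[leRHS]/(subst _ y) subst_subst {1}ey.
  by apply: eval_le => // -[[]|].
rewrite leEprod /= hy andbT; apply: le_trans hx _.
exact: subst_le.
Qed.
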